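(* Let $n,d\ge1$ be integers, let $K$ be a number field, and let $$X_d^{2n}=\left\{\sum_{i=0}^n(x_{2i}+x_{2i+1})(x_{2i}^2-x_{2i}x_{2i+1}+x_{2i+1}^2)^d=0\right\}\subset\mathbb P^{2n+1}.$$ Let $X^{2n}_{d,B}(K)$ be the set of $K$-rational points of $X_d^{2n}$ of height at most $B$ with respect to $\mathcal O_{X_d^{2n}}(1)$. Then, as $B\to\infty$, $$\#X^{2n}_{d,B}(K)\gg B^{\frac{2n+1}{2d+2}}.$$ If $n=1$, then the lower bound improves to $$\#X^2_{d,B}(K)\gg B^{\frac{3}{2d+1}}.$$
   Context: The height with respect to $\mathcal O_{X_d^{2n}}(1)$ is the restriction to $X_d^{2n}(K)$ of the usual multiplicative height on $\mathbb P^{2n+1}(K)$. Over $\mathbb Q$, a point with representative $[q_0:\dots:q_{2n+1}]$, $q_i\in\mathbb Z$, $\gcd(q_0,\dots,q_{2n+1})=1$, has height $\max_i|q_i|$, and this is extended to number fields in the standard way (Bombieri–Gubler, Definition 1.5.4). The notation $f(B)\gg g(B)$ means $f(B)\ge c\,g(B)$ for some constant $c>0$ and all sufficiently large $B$. *)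

(* Defs.v *)
From HB Require Import structures.
From mathcomp Require Import all_boot all_order all_algebra all_field.
From mathcomp Require Import all_classical all_reals all_analysis.
From mathcomp Require Import finmap complex.

Set Implicit Arguments.
Unset Strict Implicit.
Unset Printing Implicit Defensive.

Import Order.TTheory GRing.Theory Num.Theory.
Import numFieldNormedType.Exports.

Local Open Scope classical_set_scope.
Local Open Scope ring_scope.

(* A number field is a [K : fieldExtType rat]; its degree is [\dim {:K}].     *)

Section Height.
Variables (R : realType) (K : fieldExtType rat).

(* A complex place is counted through its two conjugate embeddings, which     *)
(* accounts for its local degree 2.                                           *)
Definition embeddings : set (K -> R[i]) :=
  range (fun s : {rmorphism K -> R[i]} => s : K -> R[i]).

Definition nonarch_abs (v : K -> R) : Prop :=
  [/\ v 0 = 0, forall x, x != 0 -> 0 < v x,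
      {morph v : x y / x * y} &
      forall x y, v (x + y) <= Num.max (v x) (v y)].

(* The residue field of v, as the set of cosets x + {v < 1} with v x <= 1.    *)
Definition residue_field (v : K -> R) : set (set K) :=
  [set [set y | v (y - x) < 1] | x in [set x | v x <= 1]].

(* Each finite place is represented by its unique normalized absolute value,  *)
(* for which |pi|_v = 1 / N(v) with pi a uniformizer and N(v) the cardinality *)
(* of the residue field; this is |N_(K_v/Q_p)(x)|_p in terms of completions.  *)
(* The condition pi != 0 excludes the trivial absolute value and, as it gives *)
(* 0 < v pi, forces the residue field to be finite.                           *)
Definition finite_places : set (K -> R) :=
  [set v | nonarch_abs v /\
    exists pi : K, [/\ pi != 0, v pi < 1,
      forall y, v y < 1 -> v y <= v pi &
      v pi = (#|` fset_set (residue_field v)|%:R)^-1]].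

(* The absolute multiplicative height of homogeneous coordinates x != 0. The  *)
(* product over the finite places has finite support. By the product formula, *)
(* [height (a *: x) = height x] for a != 0.                                   *)
Definition height (m : nat) (x : 'rV[K]_m.+1) : R :=
  ((\big[*%R/1]_(s \in embeddings)
      \big[Num.max/0]_(i < m.+1) ComplexField.Normc.normc (s (x ord0 i))) *
   (\big[*%R/1]_(v \in finite_places)
      \big[Num.max/0]_(i < m.+1) v (x ord0 i)))
  `^ ((\dim {:K})%:R^-1).

End Height.

(* The left-hand side of the equation of X_d^{2n}, with projective            *)
(* coordinates indexed by 'I_(2n+2).                                          *)
Definition X_form (K : fieldType) (n d : nat) (x : 'rV[K]_(n.*2.+1).+1) : K :=
  \sum_(i < n.+1)
    let a := x ord0 (inord i.*2) in
    let b := x ord0 (inord i.*2.+1) in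
    (a + b) * (a ^+ 2 - a * b + b ^+ 2) ^+ d.

(* Points of P^m(K) are the lines [<[x]>%VS] of K^(m+1), x != 0. As the       *)
(* height and the equation do not depend on the choice of homogeneous         *)
(* coordinates, a point is in this set when some x representing it satisfies  *)
(* both conditions.                                                           *)
Definition X_points (R : realType) (K : fieldExtType rat) (n d : nat) (B : R) :
    set {vspace 'rV[K]_(n.*2.+1).+1} :=
  [set P | exists x : 'rV[K]_(n.*2.+1).+1,
    [/\ x != 0, P = <[x]>%VS, X_form d x = 0 & height R x <= B]].
Arguments X_points {R} K n d B.

(* f(B) >> g(B) as B tends to infinity.                                       *)
Definition asymp_ge (R : realType) (f : R -> \bar R) (g : R -> R) : Prop :=
  exists2 c : R, 0 < c & \forall B \near +oo, ((c * g B)%:E <= f B)%E.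

(* Main.v *)
Require Import Defs.
From HB Require Import structures.
From mathcomp Require Import all_boot all_order all_algebra all_field.
From mathcomp Require Import all_classical all_reals all_analysis.
From mathcomp Require Import finmap complex.
From mathcomp Require Import zify.

Set Implicit Arguments.
Unset Strict Implicit.
Unset Printing Implicit Defensive.

Import Order.TTheory GRing.Theory Num.Theory.
Import numFieldNormedType.Exports.
Local Open Scope classical_set_scope.
Local Open Scope ring_scope.

(** The form defining X_d^{2n} has a factor x_{2i} + x_{2i+1} in each summand,
    so X_d^{2n} contains the n-dimensional linear space
    x_{2i+1} = - x_{2i} (0 <= i <= n), and the rational points of this space
    alone give the two bounds. In its affine chart x_0 = 1, the points
      [1 : -1 : k_1 : -k_1 : ... : k_n : -k_n],  k_i in {0, ..., floor B},
    are pairwise distinct and there are at least B^n of them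
    ([X_points_ge]), for every number field K. Since d >= 1 and n >= 1,
    (2n+1)/(2d+2) <= (2n+1)/4 <= n, and for n = 1 also 3/(2d+1) <= 1 = n.

    It remains to see that these points have height at most B over every K
    ([height_int_le]). At a finite place, integers have absolute value at most
    1. At each embedding of K in the complex numbers, the local factor is the
    largest usual absolute value of a coordinate, hence at most B; there are
    at most [K : Q] embeddings ([size_embeddings]), so their total contribution
    is at most B^[K : Q], of which the height takes the [K : Q]-th root. *)

(** * Embeddings of a number field *)

Lemma number_field_simple (K : fieldExtType rat) :
  exists z : K, {:K}%VS = <<1%AS; z>>%VS.
Proof.
exists (separable_generator 1%AS {:K}%AS).
apply: (@eq_adjoin_separable_generator rat K {:K}%AS 1%AS); last exact: subvf.
apply/separableP=> y _; apply: pcharf0_separable => p.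
by rewrite (fmorph_pchar (in_alg K)) pchar_num.
Qed.

(** Morphisms between fields of characteristic 0 fix the rationals; this is why
    an embedding is known once its value at a primitive element is. *)
Lemma rat_poly_rmorph (K : fieldExtType rat) (F : fieldType)
    (s : {rmorphism K -> F}) (p : {poly rat}) (z : K) :
  s (map_poly (in_alg K) p).[z] = (map_poly ratr p).[s z].
Proof.
rewrite -horner_map /= -map_poly_comp.
congr (_.[_]); apply: eq_map_poly => c /=.
exact: (fmorph_eq_rat (s \o in_alg K)).
Qed.

(** Evaluation at a primitive element z is injective on embeddings, and sends
    them to roots of the minimal polynomial of z over Q, whose degree is
    [K : Q]. *)
Lemma size_embeddings (R : realType) (K : fieldExtType rat) (r : seq (K -> R[i])) :
  uniq r -> {in r, forall f, embeddings f} -> (size r <= \dim {:K})%N.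
Proof.
move=> r_uniq r_emb; have [z Kz] := number_field_simple K.
have /polyOver1P[q minE] := minPolyOver 1%AS z.
have q0 : q != 0.
  apply/eqP => q0; move: (monic_neq0 (monic_minPoly 1%AS z)).
  by rewrite minE q0 rmorph0 eqxx.
have sizeq : size q = (\dim {:K}).+1.
  rewrite Kz dim_Fadjoin dimv1 muln1 -size_minPoly minE.
  by rewrite size_map_poly.
rewrite -ltnS -sizeq -(size_map_poly (ratr : {rmorphism rat -> R[i]})).
rewrite -(size_map (fun f : K -> R[i] => f z)).
apply: max_poly_roots.
- by rewrite map_poly_eq0.
- apply/allP => _ /mapP[f /r_emb[s _ <-] ->].
  by rewrite /root -rat_poly_rmorph -minE minPolyxx rmorph0.
- rewrite map_inj_in_uniq // => f g /r_emb[s _ <-] /r_emb[t _ <-] stz.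
  apply/funext => y; have : y \in <<1%AS; z>>%VS by rewrite -Kz memvf.
  case/Fadjoin_polyP => p /polyOver1P[p' ->] ->.
  by rewrite !rat_poly_rmorph stz.
Qed.

(** * Heights of integer vectors *)

(** The ultrametric inequality propagates the bound from 1 to its multiples. *)
Lemma nonarch_abs_int (R : realType) (K : fieldExtType rat) (v : K -> R)
    (m : int) : nonarch_abs v -> v m%:~R <= 1.
Proof.
case=> v0 v_gt0 vM vD.
have v1 : v 1 = 1.
  by apply: (mulfI (lt0r_neq0 (v_gt0 _ (oner_neq0 K)))); rewrite -vM !mulr1.
have vN1 : v (-1) = 1.
  apply/eqP; rewrite -(@eqrXn2 _ 2) ?ler01 ?expr1n ?expr2 -?vM ?mulrNN ?mulr1 ?v1 //.
  by apply/ltW/v_gt0; rewrite oppr_eq0 oner_neq0.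
have v_nat (k : nat) : v k%:R <= 1.
  elim: k => [|k IHk]; first by rewrite v0 ler01.
  by rewrite mulrS (le_trans (vD _ _)) // ge_max v1 lexx.
case: m => k; first exact: v_nat.
by rewrite NegzE mulrNz -mulN1r vM vN1 mul1r v_nat.
Qed.

Lemma normc_int (R : realType) (m : int) :
  ComplexField.Normc.normc (m%:~R : R[i]) = `|m|%:~R :> R.
Proof.
rewrite -(rmorph_int (@real_complex R)) /= expr0n addr0 sqrtr_sqr.
by rewrite intr_norm.
Qed.

(** The bound on duplicate-free sequences in A expresses that A has at most k
    elements. The hypothesis 1 <= c is for the case where fewer than k
    factors differ from 1. *)
Lemma fsbig_prod_le_expr (R : realType) (T : choiceType) (A : set T)
    (f : T -> R) (c : R) (k : nat) :
  1 <= c -> (forall x, A x -> 0 <= f x <= c) ->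
  (forall r : seq T, uniq r -> {in r, forall x, A x} -> (size r <= k)%N) ->
  \big[*%R/1]_(x \in A) f x <= c ^+ k.
Proof.
move=> c1 fA cardA; case: finite_supportP => [_|X XA _ _].
  by rewrite big_nil exprn_ege1.
have XAin : {in X, forall x, A x} by move=> x /XA.
apply: (@le_trans _ _ (c ^+ size X)).
  have -> : c ^+ size X = \prod_(x <- X) c.
    by rewrite big_const_seq count_predT iter_mulr_1.
  rewrite !big_seq; apply: ler_prod => x /XAin; exact: fA.
by rewrite ler_weXn2l // cardA.
Qed.

Lemma bigmax0_ler (R : realType) (m : nat) (f : 'I_m -> R) (c : R) :
  0 <= c -> (forall i, f i <= c) -> 0 <= \big[Num.max/0]_(i < m) f i <= c.
Proof.
move=> c0 fc; apply/andP; split; last by apply: bigmax_le.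
by apply: bigmax_ge_id.
Qed.

Lemma height_int_le (R : realType) (K : fieldExtType rat) (m : nat)
    (x : 'rV[K]_m.+1) (a : 'I_m.+1 -> int) (c : R) :
  1 <= c -> (forall i, x ord0 i = (a i)%:~R) -> (forall i, `|a i|%:~R <= c) ->
  height R x <= c.
Proof.
move=> c1 xa ac; have c0 : 0 <= c := le_trans ler01 c1.
have dimK : (\dim {:K} != 0)%N by rewrite -lt0n adim_gt0.
have arch (s : K -> R[i]) : embeddings s ->
    0 <= \big[Num.max/0]_(i < m.+1) ComplexField.Normc.normc (s (x ord0 i)) <= c.
  case=> t _ <-; apply: bigmax0_ler => // i.
  by rewrite xa rmorph_int normc_int.
have nonarch (v : K -> R) : finite_places v ->
    0 <= \big[Num.max/0]_(i < m.+1) v (x ord0 i) <= 1.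
  by case=> vabs _; apply: bigmax0_ler => // i; rewrite xa nonarch_abs_int.
have nonarch_prod : 0 <= \big[*%R/1]_(v \in @finite_places R K)
    \big[Num.max/0]_(i < m.+1) v (x ord0 i) <= 1.
  case: finite_supportP => [_|X XA _ _]; first by rewrite big_nil ler01 lexx.
  rewrite big_seq; elim/big_ind: _ => [|u w /andP[u0 u1] /andP[w0 w1]|v /XA].
  - by rewrite ler01 lexx.
  - by rewrite mulr_ge0 // mulr_ile1.
  - exact: nonarch.
have arch_prod := fsbig_prod_le_expr c1 arch (@size_embeddings R K).
rewrite /height.
apply: (@le_trans _ _ ((c ^+ \dim {:K}) `^ (\dim {:K})%:R^-1)); last first.
  by rewrite -powR_mulrn // -powRrM mulfV ?powRr1 // pnatr_eq0.
have arch_ge0 : 0 <= \big[*%R/1]_(s \in @embeddings R K)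
    \big[Num.max/0]_(i < m.+1) ComplexField.Normc.normc (s (x ord0 i)).
  case: finite_supportP => [_|X XA _ _]; first by rewrite big_nil ler01.
  by rewrite big_seq; apply: prodr_ge0 => s /XA/arch/andP[].
case/andP: nonarch_prod => n0 n1.
apply: ge0_ler_powR; rewrite ?nnegrE ?invr_ge0 ?ler0n ?mulr_ge0 ?exprn_ge0 //.
by rewrite -[leRHS]mulr1 ler_pM.
Qed.

(** * Points on a linear subspace of the variety *)

Lemma card_le_counting (R : realType) (T : finType) (U : choiceType) (A : set U)
    (f : T -> U) :
  injective f -> (forall t, A (f t)) ->
  (#|T|%:R%:E <= counting A :> \bar R)%E.
Proof.
move=> f_inj fA; rewrite /counting; case: ifPn => [/asboolP finA|_].
  rewrite lee_fin ler_nat cardE -(size_map f).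
  apply: uniq_leq_size => [|_ /mapP[t _ ->]].
    by rewrite map_inj_uniq ?enum_uniq.
  by rewrite in_fset_set // mem_set.
exact: leey.
Qed.

(** The vector (s_0, -s_0, s_1, -s_1, ..., s_n, -s_n), with s extended by 0.
    The sign is kept inside the integer cast so that [height_int_le] applies
    directly. *)
Definition alternating_pairs (K : fieldType) (n : nat) (s : seq nat) :
    'rV[K]_(n.*2.+1).+1 :=
  \row_j ((-1) ^+ j * (nth 0%N s j./2)%:Z)%:~R.

Lemma X_form_alternating_pairs (K : fieldType) (n d : nat) (s : seq nat) :
  X_form d (alternating_pairs K n s) = 0.
Proof.
rewrite /X_form big1 // => i _ /=.
have i2 : (i.*2.+1 < n.*2.+2)%N by have := ltn_ord i; lia.
rewrite !mxE !inordK ?(ltnW i2) //= uphalf_double doubleK exprS -signr_odd odd_double.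
by rewrite expr0 mulr1 mulN1r mul1r mulrNz subrr mul0r.
Qed.

Lemma height_alternating_pairs (R : realType) (K : fieldExtType rat) (n : nat)
    (s : seq nat) (B : R) :
  1 <= B -> {in s, forall k, k%:R <= B} ->
  height R (alternating_pairs K n s) <= B.
Proof.
move=> B1 sB.
apply: (@height_int_le _ _ _ _ (fun j => (-1) ^+ j * (nth 0%N s j./2)%:Z)) => //.
  by move=> j; rewrite mxE.
move=> j; rewrite normrM normrX normrN1 expr1n mul1r.
have [js|sj] := ltnP j./2 (size s); first by apply/sB/mem_nth.
by rewrite nth_default // (le_trans ler01).
Qed.

(** The leading coordinate 1 normalizes the representative of a line: two
    vectors spanning the same line are proportional with factor 1. *)
Lemma alternating_pairs_inj (K : fieldExtType rat) (n : nat) (u w : n.-tuple nat) :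
  <[alternating_pairs K n (1%N :: u)]>%VS =
    <[alternating_pairs K n (1%N :: w)]>%VS -> u = w.
Proof.
move=> uw.
have /vlineP[k uk] : alternating_pairs K n (1%N :: u) \in
    <[alternating_pairs K n (1%N :: w)]>%VS by rewrite -uw memv_line.
have k1 : k = 1.
  by move: (uk) => /rowP/(_ ord0); rewrite !mxE /= expr0 !mulr1 => <-.
move: uk; rewrite k1 scale1r => /rowP uw'.
apply: val_inj; apply: (@eq_from_nth _ 0%N); rewrite ?size_tuple // => i i_n.
have i2 : (i.+1.*2 < n.*2.+2)%N by lia.
move: (uw' (Ordinal i2)); rewrite !mxE /= doubleK -signr_odd odd_double.
rewrite expr0 !mul1r -!(rmorph_int (in_alg K)).
by move/fmorph_inj/intr_inj => -[].
Qed.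

Lemma X_points_ge (R : realType) (K : fieldExtType rat) (n d : nat) (B : R) :
  1 <= B -> ((B ^+ n)%:E <= counting (X_points K n d B))%E.
Proof.
move=> B1; set N := Num.truncn B.
have B0 : 0 <= B := le_trans ler01 B1.
pose pt (t : n.-tuple 'I_N.+1) :=
  <[alternating_pairs K n (1%N :: map_tuple val t)]>%VS.
have pt_inj : injective pt.
  by move=> t t' /alternating_pairs_inj/(congr1 val)/(inj_map val_inj)/val_inj.
have ptX t : X_points K n d B (pt t).
  exists (alternating_pairs K n (1%N :: map_tuple val t)); split => //.
  - apply/eqP => /rowP/(_ ord0); rewrite !mxE /= expr0 mulr1 => /eqP.
    by rewrite oner_eq0.
  - exact: X_form_alternating_pairs.
  - apply: height_alternating_pairs => // k.
    rewrite in_cons => /predU1P[->//|]; case/mapP=> i _ ->.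
    have /andP[NB _] := truncn_itv B0.
    by rewrite (le_trans _ NB) // ler_nat -ltnS ltn_ord.
apply: le_trans (card_le_counting R pt_inj ptX).
rewrite card_tuple card_ord natrX lee_fin lerXn2r ?nnegrE //.
by rewrite ltW // truncnS_gt.
Qed.

(** * The asymptotic lower bounds *)

Lemma X_points_asymp_ge (R : realType) (K : fieldExtType rat) (n d : nat) (e : R) :
  e <= n%:R ->
  asymp_ge (fun B : R => counting (X_points K n d B)) (fun B : R => B `^ e).
Proof.
move=> en; exists 1 => //.
near=> B.
have B1 : 1 <= B by near: B; apply: nbhs_pinfty_ge; rewrite num_real.
apply: le_trans (X_points_ge K n d B1).
rewrite mul1r lee_fin -powR_mulrn ?(le_trans ler01) //.
exact: ler_powR.
Unshelve. all: by end_near.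
Qed.

Theorem theorem6p2 (R : realType) (K : fieldExtType rat) (n d : nat)
    (hn : (1 <= n)%N) (hd : (1 <= d)%N) :
  asymp_ge (fun B : R => counting (X_points K n d B))
           (fun B : R => B `^ ((2 * n + 1)%N%:R / (2 * d + 2)%N%:R)) /\
  (n = 1%N ->
   asymp_ge (fun B : R => counting (X_points K n d B))
            (fun B : R => B `^ (3%:R / (2 * d + 1)%N%:R))).
Proof.
split=> [|n1]; apply: X_points_asymp_ge.
- rewrite ler_pdivrMr ?ltr0n ?addn2 // -natrM ler_nat.
  (* 2n+1 <= 4n since n >= 1, and 4n <= n(2d+2) since d >= 1. *)
  by apply: (@leq_trans (n * 4)); rewrite ?leq_mul2l; lia.
- by rewrite n1 ler_pdivrMr ?ltr0n ?addn1 // mul1r ler_nat; lia.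
Qed.
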